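(* For every integer $k \ge 1$, every oriented tree of order $k$ is $\left(8 \sqrt{\frac{2}{15}}\, k\sqrt{k} + \frac{11}{3}k + \sqrt{\frac{5}{6}}\, \sqrt{k} + 1\right)$-universal.
   Context: All graphs and digraphs are finite and simple (no loops, no parallel arcs in the same direction); digraphs may contain digons (directed cycles of length 2), oriented graphs may not. The order of a (di)graph is its number of vertices. The chromatic number $\chi(D)$ of a digraph $D$ is the minimum number of colours in an assignment of colours to the vertices such that adjacent vertices (in either direction) receive different colours. An oriented tree is an orientation of an undirected tree. For a real number $c>0$, a digraph $H$ is $c$-universal if every digraph $D$ with $\chi(D)\ge c$ contains $H$ as a (not necessarily induced) subdigraph. *)

(* Defs.v *)
From mathcomp Require Import all_boot all_order all_algebra.
From mathcomp Require Import reals.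

Set Implicit Arguments.
Unset Strict Implicit.
Unset Printing Implicit Defensive.

Import Order.TTheory GRing.Theory Num.Theory.

(* [arc] need not be antisymmetric: digons are allowed. *)
Record digraph := Digraph {
  vertex :> finType;
  arc : rel vertex;
  arc_irrefl : irreflexive arc
}.

Record sgraph := SGraph {
  svertex :> finType;
  edge : rel svertex;
  edge_sym : symmetric edge;
  edge_irrefl : irreflexive edge
}.

Definition connected (G : sgraph) : Prop :=
  0 < #|G| /\ forall x y : G, connect (@edge G) x y.

(* A cycle is given by its cyclic sequence of distinct vertices; the size
   condition excludes the closed walk going back and forth along an edge. *)
Definition acyclic (G : sgraph) : Prop :=
  forall c : seq G, 2 < size c -> ~ ucycle (@edge G) c.

Definition tree (G : sgraph) : Prop := connected G /\ acyclic G.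

Section Digraphs.
Variable D : digraph.

Definition adjacent : rel D := fun x y => arc x y || arc y x.

Lemma adjacent_sym : symmetric adjacent.
Proof. by move=> x y; rewrite /adjacent orbC. Qed.

Lemma adjacent_irrefl : irreflexive adjacent.
Proof. by move=> x; rewrite /adjacent arc_irrefl. Qed.

Definition underlying : sgraph := SGraph adjacent_sym adjacent_irrefl.

Definition oriented : Prop := forall x y : D, arc x y -> ~~ arc y x.

Definition oriented_tree : Prop := oriented /\ tree underlying.

Definition colourable (n : nat) : bool :=
  [exists f : {ffun D -> 'I_n},
    [forall x, forall y, adjacent x y ==> (f x != f y)]].

Lemma colourable_card : exists n, colourable n.
Proof.
exists #|D|; apply/existsP; exists [ffun x => enum_rank x].
apply/forallP=> x; apply/forallP=> y; apply/implyP=> xy.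
rewrite !ffunE (inj_eq enum_rank_inj); apply: contraTneq xy => ->.
by rewrite adjacent_irrefl.
Qed.

Definition chi : nat := ex_minn colourable_card.

End Digraphs.

Definition contains (D H : digraph) : Prop :=
  exists f : H -> D, injective f /\ forall x y : H, arc x y -> arc (f x) (f y).

Definition universal (R : realType) (c : R) (H : digraph) : Prop :=
  forall D : digraph, (c <= (chi D)%:R)%R -> contains D H.

(* Main.v *)
Require Import Defs.
From mathcomp Require Import all_boot all_order all_algebra.
From mathcomp Require Import reals zify ring lra.
Import Defs.

Set Implicit Arguments.
Unset Strict Implicit.
Unset Printing Implicit Defensive.

Import Order.TTheory GRing.Theory Num.Theory.

(** The tree is dismantled part by part. The number of colours is subadditive
    under unions of vertex sets; hence, to find a tree S in a set A of vertices
    of D, it is enough to set aside a set X that needs few colours and such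
    that a chosen pendant part of S can be attached at every vertex outside X,
    because there is a copy of it inside X or because that vertex has many
    neighbours: the rest of S is found outside X by induction. The cost of the
    part is the number of colours spent on X, and [forced S m] says that
    the total cost of S is at most m. Let n be the order of S.

    All leaves of S of one direction (all entered, or all left, by their arc)
    cost 2n, by [forced_leaves_of]: the vertices with fewer than n
    out-neighbours induce a sparse graph, which is coloured greedily, and at
    every other vertex the leaves can be added one by one.

    A pendant path with p vertices, whatever its orientation, costs
    n - 1 + p(p-1)/2, by [forced_add_path]. This is the heart of the proof. In
    an acyclic set a leaf costs one colour only, because there is a stable set
    K (a kernel) that every other vertex sends an arc into; so an acyclic set
    without a copy of S is (n-1)-colourable ([acyclic_embeds]). Take a maximal
    acyclic subset M of the current zone W (at first W is A): each vertex of W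
    outside M has both an in-neighbour and an out-neighbour in M. Peel from M
    one kernel for each vertex of the path but the first; the remainder R0 of M
    consists of first vertices of copies of the path. The vertices of W outside
    M that have a neighbour in R0, in the direction of the arc that attaches the
    path, are served. The others form the next zone. They have a neighbour in M
    in any direction, so each of them already starts a copy of the last two
    vertices of the path, and next time one kernel fewer has to be peeled, and
    so on. The new zone has no arc to R0 in the attaching direction; therefore
    the union of all the remainders is still acyclic and costs n - 1 in total,
    not n - 1 each time, while the kernels cost (p-1) + ... + 1. This is
    [absorbing_set].

    It remains to balance the two operations ([forced_order_bound]). If S has at
    least 0.93 sqrt n leaves, at least half of them have the same direction, and
    removing these pays: a cost of 2n for 0.465 sqrt n vertices is less than the
    growth of 2.92 n sqrt n + (11/3) n. Otherwise S is cut into at most p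
    pendant paths with p vertices and at most one shorter path for each leaf,
    where p is about sqrt n; each costs at most about 3n/2, which adds up, apart from terms
    of lower order, to less than 2.9 n sqrt n. Finally 2.92 < 8 sqrt(2/15). *)

(** * Colouring sets of vertices *)

Definition dir (G : digraph) (b : bool) : rel G :=
  fun x y => if b then arc x y else arc y x.
Arguments dir {G}.

Lemma dirN (G : digraph) b (x y : G) : dir (~~ b) x y = dir b y x.
Proof. by case: b. Qed.

Lemma adjacentE (G : digraph) b (x y : G) : adjacent x y = dir b x y || dir b y x.
Proof. by rewrite /adjacent; case: b => //; rewrite orbC. Qed.

Lemma dir_irrefl (G : digraph) b : irreflexive (@dir G b).
Proof. by case: b => x; rewrite /dir arc_irrefl. Qed.

Section Colouring.
Variable D : digraph.
Implicit Types (A B K L M N R W X : {set D}) (v w : D) (b : bool).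

Definition colourable_on A n :=
  exists2 c : D -> nat, {in A, forall x, c x < n} &
    {in A &, forall x y, adjacent x y -> c x != c y}.

Definition nbrs b A v := [set w in A | dir b v w].

Lemma colourable_onS A B n : A \subset B -> colourable_on B n -> colourable_on A n.
Proof.
move=> /subsetP sAB [c cn cP]; exists c => [x /sAB|x y /sAB xB /sAB yB]; first exact: cn.
exact: cP.
Qed.

Lemma colourable_onW A m n : m <= n -> colourable_on A m -> colourable_on A n.
Proof. by move=> mn [c cm cP]; exists c => // x /cm /leq_trans; apply. Qed.

Lemma colourable_onU A B m n :
  colourable_on A m -> colourable_on B n -> colourable_on (A :|: B) (m + n).
Proof.
move=> [c cm cP] [d dn dP].
exists (fun x => if x \in A then c x else m + d x) => [x|x y].
  by rewrite inE; case: ifP => [xA _|_ /= /dn]; [have := cm _ xA; lia | lia].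
rewrite !inE; case: ifP => xA; case: ifP => yA /= xAB yAB xy.
- exact: cP.
- by have := cm _ xA; lia.
- by have := cm _ yA; lia.
- by rewrite eqn_add2l dP.
Qed.

Lemma colourable_on0 n : colourable_on set0 n.
Proof. by exists (fun=> 0) => x; rewrite inE. Qed.

Lemma colourable_on_stable A : {in A &, forall x y, ~~ adjacent x y} -> colourable_on A 1.
Proof. by move=> st; exists (fun=> 0) => // x y xA yA; rewrite (negPf (st _ _ xA yA)). Qed.

Lemma colourable_on_setT n : colourable_on setT n -> chi D <= n.
Proof.
move=> [c cn cP]; rewrite /chi; case: ex_minnP => m _; apply.
have cn' x : c x < n by apply: cn.
apply/existsP; exists [ffun x => Ordinal (cn' x)].
apply/forallP=> x; apply/forallP=> y; apply/implyP=> xy.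
by rewrite !ffunE -val_eqE /= cP.
Qed.

(** Within B the two directions have the same total degree, so the average total
    degree is at most twice the bound on one of them. *)
Lemma exists_low_degree b d B : B != set0 ->
    {in B, forall v, #|nbrs b B v| <= d} ->
  exists2 v, v \in B & #|[set w in B | adjacent v w]| <= d.*2.
Proof.
move=> B0 Bd.
have nE b' v : #|nbrs b' B v| = \sum_(w in B) dir b' v w.
  rewrite -sum1_card (eq_bigl (fun w => (w \in B) && dir b' v w)) => [|w].
    by rewrite big_mkcondr /=; apply: eq_bigr => w _; case: dir.
  by rewrite !inE.
have le_sum : \sum_(v in B) (#|nbrs b B v| + #|nbrs (~~ b) B v|) <= #|B| * d.*2.
  rewrite big_split /= -addnn mulnDr.
  have -> : \sum_(v in B) #|nbrs (~~ b) B v| = \sum_(v in B) #|nbrs b B v|.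
    under eq_bigr do rewrite nE; under [RHS]eq_bigr do rewrite nE.
    rewrite exchange_big; apply: eq_bigr => v _; apply: eq_bigr => w _.
    by rewrite dirN.
  by rewrite leq_add // -sum_nat_const leq_sum.
have [v /andP[vB vd']|noB] :=
  pickP (fun v => (v \in B) && (#|nbrs b B v| + #|nbrs (~~ b) B v| <= d.*2)).
  exists v => //; apply: leq_trans vd'.
  apply: leq_trans (leq_card_setU _ _); rewrite subset_leq_card //.
  by apply/subsetP=> w; rewrite !inE dirN (adjacentE b) -andb_orr.
have : \sum_(v in B) d.*2.+1 <= \sum_(v in B) (#|nbrs b B v| + #|nbrs (~~ b) B v|).
  by apply: leq_sum => v vB; have := noB v; rewrite vB /=; lia.
rewrite sum_nat_const; move: B0; rewrite -card_gt0; nia.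
Qed.

Lemma colourable_on_sparse b d B :
  {in B, forall v, #|nbrs b B v| <= d} -> colourable_on B d.*2.+1.
Proof.
have [n] := ubnP #|B|; elim: n B => // n IHn B Bn Bd.
have [->|B0] := eqVneq B set0; first exact: colourable_on0.
have [v vB vd] := exists_low_degree B0 Bd.
have [|w|c cn cP] := IHn (B :\ v); first by rewrite (cardsD1 v B) vB in Bn.
  move=> wB; apply: leq_trans (Bd w _); last by case/setD1P: wB.
  by apply/subset_leq_card/subsetP=> u; rewrite !inE => /andP[/andP[_ ->]].
pose N := [set w in B | adjacent v w].
have [i iP] : exists i : 'I_d.*2.+1, (i : nat) \notin [seq c w | w in N].
  apply/existsP/contraT => /existsPn ci.
  have : #|'I_d.*2.+1| <= size [seq c w | w in N].
    rewrite cardE -(size_map val); apply: uniq_leq_size.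
      by rewrite map_inj_uniq ?enum_uniq //; apply: val_inj.
    by move=> _ /mapP[j _ ->]; have := ci j; rewrite negbK.
  by rewrite card_ord size_map -cardE leqNgt ltnS vd.
have ciP w : w \in B -> adjacent v w -> c w != i.
  move=> wB vw; apply: contraNneq iP => <-.
  by apply/mapP; exists w; rewrite // mem_enum inE wB.
exists (fun w => if w == v then nat_of_ord i else c w) => [w wB|w u wB uB wu].
  by case: eqP => // /eqP wv; apply: cn; rewrite !inE wv.
case: (eqVneq w v) wu => [->|wv]; case: (eqVneq u v) => [->|uv] wu.
- by rewrite adjacent_irrefl in wu.
- by rewrite eq_sym ciP.
- by rewrite ciP // adjacent_sym.
- by rewrite cP // !inE ?wv ?uv.
Qed.

(** * Acyclic sets and kernels *)

(** Acyclicity in the form in which it is used: every nonempty subset has a sink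
    and, with the other value of b, a source. *)
Definition acyclic_on M :=
  forall b N, N \subset M -> N != set0 -> exists2 v, v \in N & nbrs b N v = set0.

Lemma acyclic_onS M N : N \subset M -> acyclic_on M -> acyclic_on N.
Proof. by move=> sNM acM b L sLN; apply: acM; apply: subset_trans sNM. Qed.

Lemma acyclic_on0 : acyclic_on set0.
Proof. by move=> b N; rewrite subset0 => /eqP->; rewrite eqxx. Qed.

Lemma nbrs0P b A v : reflect (forall w, w \in A -> ~~ dir b v w) (nbrs b A v == set0).
Proof.
apply: (iffP eqP) => [n0 w wA|nP].
  by apply/negP => vw; have := in_set0 w; rewrite -n0 inE wA vw.
by apply/setP=> w; rewrite !inE; apply/andP => -[/nP/negPf->].
Qed.

(** A directed cycle through v enters and leaves v. *)
Lemma acyclic_onU1 b M v : acyclic_on M -> nbrs b M v = set0 -> acyclic_on (v |: M).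
Proof.
move=> acM /eqP/nbrs0P nv c N sN N0; have [vN|vN] := boolP (v \in N); last first.
  by apply: acM => //; apply/subsetP=> x xN; have /setU1P[xv|] := subsetP sN x xN;
     first by rewrite -xv xN in vN.
have nvN w : w \in N -> ~~ dir b v w.
  by move=> wN; have /setU1P[->|/nv] := subsetP sN w wN; first by rewrite dir_irrefl.
have [->|cb] := eqVneq c b; first by exists v => //; apply/eqP/nbrs0P.
have {cb}-> : c = ~~ b by case: c b cb {nv nvN} => [] [].
have [Nv|Nv] := eqVneq (N :\ v) set0.
  exists v => //; apply/eqP/nbrs0P=> w wN; have := in_set0 w; rewrite -Nv !inE wN andbT.
  by move/negbFE/eqP->; rewrite dir_irrefl.
have [|x] := acM (~~ b) _ _ Nv.
  apply/subsetP=> x /setD1P[xv xN]; have /setU1P[xv'|//] := subsetP sN x xN.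
  by rewrite xv' eqxx in xv.
case/setD1P=> xv xN /eqP/nbrs0P nx; exists x => //; apply/eqP/nbrs0P=> w wN.
by have [->|wv] := eqVneq w v; [rewrite dirN nvN | apply: nx; rewrite !inE wv].
Qed.

(** A directed cycle cannot cross from M to N and back if the arcs between M and N
    all have the same direction. *)
Lemma acyclic_onU b M N : acyclic_on M -> acyclic_on N ->
  {in N & M, forall v w, ~~ dir b v w} -> acyclic_on (M :|: N).
Proof.
have gen c M' N' L : acyclic_on M' -> acyclic_on N' ->
    {in N' & M', forall v w, ~~ dir c v w} -> L \subset M' :|: N' -> L != set0 ->
    exists2 v, v \in L & nbrs c L v = set0.
  move=> acM acN noarc sL L0.
  have [L0'|LN0] := eqVneq (L :&: N') set0.
    apply: acM => //; apply/subsetP=> x xL; have /setUP[//|xN] := subsetP sL x xL.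
    by have := in_set0 x; rewrite -L0' inE xL xN.
  have [v /setIP[vL vN] /eqP/nbrs0P nv] := acN c _ (subsetIr L N') LN0.
  exists v => //; apply/eqP/nbrs0P=> w wL; have /setUP[wM|wN] := subsetP sL w wL.
    exact: noarc.
  by apply: nv; rewrite inE wL.
move=> acM acN noarc c L sL L0; have [->|cb] := eqVneq c b; first exact: (gen b M N).
have {cb}-> : c = ~~ b by case: c b cb {noarc} => [] [].
apply: (gen _ N M) => //; last by rewrite setUC.
by move=> v w vM wN; rewrite dirN noarc.
Qed.

(** By [acyclic_onU1], inclusion-maximality of M gives every other vertex of W
    neighbours in M in both directions. *)
Lemma maximal_acyclic W :
  exists M, [/\ M \subset W, acyclic_on M & forall b v, v \in W :\: M -> nbrs b M v != set0].
Proof.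
pose P n := exists M, [/\ M \subset W, acyclic_on M & #|W :\: M| = n].
suff [n [M [sMW acM Mn]] minM] : exists2 n, P n & forall m, P m -> n <= m.
  exists M; split=> // b v /setDP[vW vM]; apply/eqP => n0.
  have /minM : P #|W :\: (v |: M)|.
    exists (v |: M); split=> //; first by rewrite subUset sub1set vW.
    exact: (acyclic_onU1 acM n0).
  rewrite -Mn (cardsD1 v (W :\: M)) inE vM vW add1n.
  rewrite (_ : W :\: (v |: M) = (W :\: M) :\ v) ?ltnn //.
  by apply/setP=> x; rewrite !inE negb_or andbA.
have : P #|W :\: set0| by exists set0; split=> //; [exact: sub0set | exact: acyclic_on0].
elim/ltn_ind: (#|_|) => n IHn Pn.
have [[m mn /IHn]|min_n] := boolp.pselect (exists2 m, m < n & P m); first exact.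
exists n => // m Pm; rewrite leqNgt; apply/negP => mn; apply: min_n; by exists m.
Qed.

(** Put a sink into K, delete it together with the vertices that dominate it, and
    repeat. *)
Lemma kernel b M : acyclic_on M ->
  exists K, [/\ K \subset M, colourable_on K 1 & forall v, v \in M :\: K -> nbrs b K v != set0].
Proof.
move=> acM.
suff [K [sKM stK KP]] : exists K, [/\ K \subset M, {in K &, forall x y, ~~ adjacent x y} &
    forall v, v \in M :\: K -> nbrs b K v != set0].
  by exists K; split=> //; apply: colourable_on_stable.
have [n] := ubnP #|M|; elim: n M acM => // n IHn M acM Mn.
have [->|M0] := eqVneq M set0.
  by exists set0; split=> [|x|x]; rewrite ?sub0set ?inE.
have [v vM /eqP/nbrs0P nv] := acM b M (subxx _) M0.
pose M' := M :\: (v |: nbrs (~~ b) M v).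
have sM' : M' \subset M by apply: subsetDl.
have [|K [sKM stK KP]] := IHn M' (acyclic_onS sM' acM).
  by apply: leq_trans (_ : #|M| <= n); [apply: proper_card; apply/properP; split=> //;
     exists v; rewrite // !inE eqxx | rewrite -ltnS].
have vK x : x \in K -> ~~ adjacent v x.
  move/(subsetP sKM); rewrite !inE dirN (adjacentE b) !negb_or => /andP[/andP[_ nxv] xM].
  by rewrite nv //=; move: nxv; rewrite xM.
exists (v |: K); split=> [|x y|x].
- by rewrite subUset sub1set vM (subset_trans sKM).
- case/setU1P=> [->|xK] /setU1P[->|yK]; first by rewrite adjacent_irrefl.
  + exact: vK.
  + by rewrite adjacent_sym vK.
  + exact: stK.
- case/setDP=> xM; rewrite !inE negb_or => /andP[xv xK].
  have [xv'|nxv] := boolP (dir b x v).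
    by apply/set0Pn; exists v; rewrite !inE eqxx.
  have /KP/set0Pn[y] : x \in M' :\: K by rewrite !inE dirN xK xM (negPf xv) (negPf nxv).
  by rewrite inE => /andP[yK xy]; apply/set0Pn; exists y; rewrite !inE yK xy orbT.
Qed.

End Colouring.
(** * Setting aside an absorbing set for a path *)

Section Walks.
Variable D : digraph.
Implicit Types (B C K M R W X : {set D}) (v w : D) (b t : bool) (pre suf : seq bool).

Fixpoint walk v (bs : seq bool) (ws : seq D) : bool :=
  match bs, ws with
  | [::], [::] => true
  | b :: bs', w :: ws' => dir b v w && walk w bs' ws'
  | _, _ => false
  end.

(** Listing the directions of a path from its first arc on makes the end of the
    path a suffix of the list: suf is what the vertices of a zone already start,
    and pre is what is still missing. *)
Definition starts B bs v :=
  exists2 ws, walk v bs ws & uniq (v :: ws) /\ {subset ws <= B}.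

Lemma startsS B B' bs v : B \subset B' -> starts B bs v -> starts B' bs v.
Proof.
by move=> /subsetP sB [ws wk [us sws]]; exists ws => //; split=> // w /sws/sB.
Qed.

Lemma starts_cons B C t suf v w : dir t v w -> w \in C -> v != w -> v \notin B ->
  starts B suf w -> starts (C :|: B) (t :: suf) v.
Proof.
move=> vw wC nvw vB [ws wk [us sws]]; exists (w :: ws); first by rewrite /= vw.
split=> [|u]; first by rewrite cons_uniq us inE negb_or nvw (contra (sws v)).
by rewrite !inE => /predU1P[->|/sws->]; rewrite ?wC ?orbT.
Qed.

(** The path is found in the order opposite to the peeling: the kernel peeled first,
    for the last direction of pre, is the one entered last. *)
Lemma acyclic_starts pre suf M B : acyclic_on M -> [disjoint M & B] ->
    {in M, forall v, starts B suf v} ->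
  exists K, [/\ K \subset M, colourable_on K (size pre) &
    {in M :\: K, forall v, starts (M :|: B) (pre ++ suf) v}].
Proof.
elim/last_ind: pre suf M B => [|pre t IHpre] suf M B acM dMB sufM.
  exists set0; split=> [||v]; rewrite ?sub0set //; first exact: colourable_on0.
  by rewrite setD0 => /sufM; apply: startsS; apply: subsetUr.
have [K0 [sK0 cK0 K0P]] := kernel t acM.
have sM' : M :\: K0 \subset M by apply: subsetDl.
have [||v vM'|K [sKM cK KP]] := IHpre (t :: suf) (M :\: K0) (K0 :|: B).
- exact: acyclic_onS acM.
- rewrite -setI_eq0; apply/eqP/setP=> x; rewrite !inE; apply/negP.
  case/andP=> /andP[xK xM]; rewrite (negPf xK) /=; apply/negP.
  by rewrite (disjointFr dMB xM).
- have /set0Pn[w] := K0P v vM'; rewrite inE => /andP[wK vw]; case/setDP: vM' => vM vK.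
  apply: (starts_cons vw) => //; first by apply: contraNneq vK => ->.
    by rewrite (disjointFr dMB vM).
  by apply: sufM; apply: (subsetP sK0).
exists (K0 :|: K); split=> [||v].
- by rewrite subUset sK0 (subset_trans sKM).
- by rewrite size_rcons -add1n; apply: colourable_onU.
- rewrite cat_rcons => vMK; apply: (startsS _ (KP v _)); last first.
    by move: vMK; rewrite !inE negb_or => /andP[/andP[-> ->] ->].
  by rewrite setUA setUSS // subUset sM' sK0.
Qed.

(** The two kinds of vertices in X are charged differently: R is acyclic, so
    that its colours are bounded globally as soon as the tree is absent from it,
    while X minus R consists of the kernels of all the rounds, i of them in the
    round where i directions are missing. *)
Lemma absorbing_set b pre suf W B : [disjoint W & B] -> {in W, forall v, starts B suf v} ->
  exists X R, [/\ [/\ X \subset W, R \subset X & acyclic_on R],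
    {in W :\: X, forall v, nbrs b R v != set0},
    {in R, forall v, starts (X :|: B) (pre ++ suf) v} &
    colourable_on (X :\: R) 'C((size pre).+1, 2)].
Proof.
elim/last_ind: pre suf W B => [|pre t IHpre] suf W B dWB sufW.
  have [M [sMW acM MP]] := maximal_acyclic W.
  exists M, M; split=> // [v vW|v vM|]; first exact: MP.
    by apply: (startsS (subsetUr _ _)); apply: sufW; apply: (subsetP sMW).
  by rewrite setDv; apply: colourable_on0.
(* M serves twice: for the kernels of this round, and as the set through which
   the vertices that are not served start a path longer by one. *)
have [M [sMW acM MP]] := maximal_acyclic W.
have dMB : [disjoint M & B] := disjointWl sMW dWB.
have [|K [sKM cK KP]] := @acyclic_starts (rcons pre t) suf M B acM dMB.
  by move=> v vM; apply: sufW; apply: (subsetP sMW).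
pose R0 := M :\: K; pose W1 := [set v in W :\: M | nbrs b R0 v == set0].
have sW1 : W1 \subset W :\: M by apply/subsetP=> v; rewrite inE => /andP[].
have [||X1 [R1 [[sX1 sR1 acR1] X1P R1P cX1]]] := IHpre (t :: suf) W1 (M :|: B).
- rewrite -setI_eq0; apply/eqP/setP=> x; rewrite !inE; apply/negP.
  case/andP=> /andP[/andP[xM xW] _]; rewrite (negPf xM) /=; apply/negP.
  by rewrite (disjointFr dWB xW).
- move=> v /(subsetP sW1) vWM; have /set0Pn[w] := MP t v vWM.
  rewrite inE => /andP[wM vw]; case/setDP: vWM => vW vM.
  apply: (starts_cons vw) => //; first by apply: contraNneq vM => ->.
    by rewrite (disjointFr dWB vW).
  by apply: sufW; apply: (subsetP sMW).
exists (M :|: X1), (R0 :|: R1); split; first split.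
- by rewrite subUset sMW (subset_trans sX1) // (subset_trans sW1) // subsetDl.
- by rewrite setUSS // subsetDl.
- apply: (@acyclic_onU _ b) => //; first by apply: acyclic_onS acM; apply: subsetDl.
  move=> v w vR1 wR0; have : v \in W1 by apply: (subsetP sX1); apply: (subsetP sR1).
  by rewrite inE => /andP[_ /nbrs0P]; apply.
- move=> v; rewrite in_setD in_setU negb_or -andbA => /and3P[vM vX1 vW].
  have sub R' : R' \subset R0 :|: R1 -> nbrs b R' v != set0 -> nbrs b (R0 :|: R1) v != set0.
    move=> /subsetP sR' /set0Pn[w]; rewrite inE => /andP[/sR' wR vw].
    by apply/set0Pn; exists w; rewrite inE wR.
  have [vn|vn] := boolP (nbrs b R0 v == set0); last by apply: sub vn; apply: subsetUl.
  by apply: sub (X1P v _); [apply: subsetUr | rewrite !inE vX1 vM vW].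
- move=> v /setUP[/KP|/R1P]; first by apply: startsS; rewrite setSU // subsetUl.
  by rewrite cat_rcons; apply: startsS; rewrite setUCA setUA.
- rewrite size_rcons in cK *; rewrite binS bin1 addnC.
  apply: colourable_onS (colourable_onU cK cX1).
  apply/subsetP=> v; rewrite /R0 !inE !negb_or !negb_and !negbK.
  by case: (v \in K); case: (v \in M); case: (v \in R1); case: (v \in X1).
Qed.

End Walks.

(** * Trees as vertex sets built leaf by leaf *)

Section Trees.
Variable T : digraph.
Hypothesis orT : oriented T.
Implicit Types (S : {set T}) (x y z : T).

Definition attached S y b x :=
  [/\ x \notin S, y \in S, dir b y x & {in S, forall z, adjacent z x -> z = y}].

Inductive tree_set : {set T} -> Prop :=
| tree_set1 x : tree_set [set x]
| tree_setU1 S y b x : tree_set S -> attached S y b x -> tree_set (x |: S).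

Lemma tree_set_gt0 S : tree_set S -> 0 < #|S|.
Proof.
by elim=> [x|S0 y b x _ _ _]; [rewrite cards1 | apply/card_gt0P; exists x; rewrite setU11].
Qed.

Section Copies.
Variable D : digraph.
Implicit Types (A M : {set D}) (f : T -> D) (v w : D).

(** A copy is a function on the whole of T of which only the values on S matter,
    so that copies of growing subtrees share one type. *)
Definition copy f S A :=
  [/\ {in S &, injective f}, {in S, forall x, f x \in A} &
      {in S &, forall x y, arc x y -> arc (f x) (f y)}].

Definition embeds S A := exists f, copy f S A.

Lemma copyS f S S' A A' : S' \subset S -> A \subset A' -> copy f S A -> copy f S' A'.
Proof.
move=> /subsetP sS /subsetP sA [fI fA farc]; split=> [x y xS yS|x xS|x y xS yS].
- by apply: fI; apply: sS.
- by apply: sA; apply: fA; apply: sS.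
- by apply: farc; apply: sS.
Qed.

Lemma copyU1 f S A y b x w : copy f S A -> attached S y b x ->
    w \in A -> w \notin f @: S -> dir b (f y) w ->
  copy (fun z => if z == x then w else f z) (x |: S) A.
Proof.
move=> [fI fA farc] [xS yS yx xy] wA wS fyw.
have neq z : z \in S -> (z == x) = false by move=> zS; apply: contraNF xS => /eqP<-.
have wf z : z \in S -> f z != w by move=> zS; apply: contraNneq wS => <-; apply: imset_f.
have nyx : ~~ dir b x y.
  by case: b yx {fyw} => yx; [exact: orT yx | exact: (orT yx)].
split=> [u z|u|u z].
- case/setU1P=> [->|uS] /setU1P[->|zS]; rewrite ?eqxx ?neq //.
  + by move=> /eqP; rewrite eq_sym (negPf (wf z zS)).
  + by move=> /eqP; rewrite (negPf (wf u uS)).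
  + exact: fI.
- by case/setU1P=> [->|uS]; rewrite ?eqxx ?neq //; apply: fA.
- case/setU1P=> [->|uS] /setU1P[->|zS]; rewrite ?eqxx ?neq //; last exact: farc.
  + by rewrite arc_irrefl.
  + move=> xz; have zy : z = y by apply: xy => //; rewrite /adjacent xz orbT.
    rewrite zy in xz *; case: b yx nyx fyw => //= _; by rewrite /dir xz.
  + move=> ux; have uy : u = y by apply: xy => //; rewrite /adjacent ux.
    rewrite uy in ux *; case: b yx nyx fyw => //= _; by rewrite /dir ux.
Qed.

(** Removing a kernel costs one colour and leaves a set in which every vertex can
    receive the last leaf of the tree inside the kernel. *)
Lemma acyclic_embeds S M : tree_set S -> acyclic_on M ->
  embeds S M \/ colourable_on M #|S|.-1.
Proof.
move=> trS; elim: trS M => [x|S0 y b x trS IH att] M acM.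
  have [->|[v vM]] := set_0Vmem M; first by right; apply: colourable_on0.
  left; exists (fun=> v); split=> // [y z /set1P-> /set1P->|y z /set1P-> /set1P->] //.
  by rewrite arc_irrefl.
have [K [sKM cK KP]] := kernel b acM; case: (att) => xS yS _ _.
case: (IH (M :\: K)); first by apply: acyclic_onS acM; apply: subsetDl.
- move=> [f fc]; left; case: (fc) => fI fA farc.
  have /set0Pn[w] := KP _ (fA y yS); rewrite inE => /andP[wK fyw].
  exists (fun z => if z == x then w else f z).
  apply: (copyU1 _ att) fyw; first exact: copyS (subxx _) (subsetDl _ _) fc.
    exact: (subsetP sKM).
  by apply/imsetP=> -[z /fA/setDP[_ fzK] wz]; rewrite wz (negPf fzK) in wK.
- move=> cM; right; rewrite cardsU1 xS /=.
  rewrite -[X in colourable_on _ X](prednK (tree_set_gt0 trS)) -addn1.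
  by apply: colourable_onS (colourable_onU cM cK); apply/subsetP=> v vM;
     rewrite !inE vM andbT orNb.
Qed.

End Copies.

(** * The cost of a pendant path *)

Definition forced S m :=
  forall (D : digraph) (A : {set D}), embeds S A \/ colourable_on A m.

Lemma forcedW S m n : m <= n -> forced S m -> forced S n.
Proof.
by move=> mn fS D A; have [|cA] := fS D A; [left | right; apply: colourable_onW cA].
Qed.

Lemma forced1 x : forced [set x] 0.
Proof.
move=> D A; have [->|[v vA]] := set_0Vmem A; first by right; apply: colourable_on0.
left; exists (fun=> v); split=> // [y z /set1P-> /set1P->|y z /set1P-> /set1P->] //.
by rewrite arc_irrefl.
Qed.

Fixpoint add_path S (l : seq (bool * T)) : {set T} :=
  if l is (_, z) :: l' then add_path (z |: S) l' else S.

(** The path l, given by the direction of each arc and its end, can be added to S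
    at y without creating other adjacencies. *)
Fixpoint pendant_path S y (l : seq (bool * T)) : Prop :=
  if l is (b, z) :: l' then attached S y b z /\ pendant_path (z |: S) z l' else True.

Lemma tree_set_add_path S y l : tree_set S -> pendant_path S y l -> tree_set (add_path S l).
Proof.
elim: l S y => //= -[b z] l IHl S y trS [att hl]; apply: IHl hl; exact: tree_setU1 att.
Qed.

Lemma card_add_path S y l : pendant_path S y l -> #|add_path S l| = #|S| + size l.
Proof.
elim: l S y => [|[b z] l IHl] S y /=; first by rewrite addn0.
by case=> -[zS _ _ _] /IHl->; rewrite cardsU1 zS add1n addnS.
Qed.

Lemma copy_add_path (D : digraph) (A : {set D}) f S y l ws :
    copy f S A -> pendant_path S y l -> walk (f y) (unzip1 l) ws -> uniq ws ->
    {subset ws <= A} -> {in ws, forall w, w \notin f @: S} -> embeds (add_path S l) A.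
Proof.
elim: l S y f ws => [|[b z] l IHl] S y f [|w ws] //=; first by exists f.
move=> fc [att hl] /andP[fyw wk] /andP[wws uws] sws wf.
have zS : z \notin S by case: att.
have wA : w \in A by apply: sws; rewrite mem_head.
have wfS : w \notin f @: S by apply: wf; rewrite mem_head.
have fc' := copyU1 fc att wA wfS fyw.
apply: (IHl _ z _ ws fc') => //; first by rewrite eqxx.
  by move=> u uws'; apply: sws; rewrite inE uws' orbT.
move=> u uws'; apply/imsetP => -[t /setU1P[->|tS]].
  by rewrite eqxx => uw; rewrite -uw uws' in wws.
case: eqP => [tz|_ ut]; first by rewrite -tz tS in zS.
by have := wf u; rewrite inE uws' orbT ut imset_f // => /(_ isT).
Qed.

(** If R contains S there is nothing to do; otherwise R is (|S|-1)-colourable, and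
    the tree without the path is sought outside X. *)
Lemma forced_add_path S u l m : tree_set S -> u \in S -> pendant_path S u l -> forced S m ->
  forced (add_path S l) (m + (#|add_path S l|.-1 + 'C(size l, 2))).
Proof.
case: l => [|[b z] l] trS uS hl fS; first by apply: forcedW fS; rewrite leq_addr.
have trSl := tree_set_add_path trS hl; move=> D A.
have [||X [R [[sXA sRX acR] absorb startR cXR]]] := @absorbing_set D b (unzip1 l) [::] A set0.
- by rewrite -setI_eq0 setI0.
- by move=> v _; exists [::] => //; split=> // w.
have [[f fc]|cR] := acyclic_embeds trSl acR.
  by left; exists f; apply: copyS fc => //; apply: subset_trans sRX sXA.
have [[f fc]|cA] := fS D (A :\: X).
  left; have fuAX : f u \in A :\: X by case: fc => _ fA _; apply: fA.
  have /set0Pn[r] := absorb _ fuAX; rewrite inE => /andP[rR fur].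
  have [ws wk [us sws]] := startR r rR; rewrite cats0 in wk; rewrite setU0 in sws.
  have sX : {subset r :: ws <= X}.
    by move=> w; rewrite inE => /predU1P[->|/sws//]; apply: (subsetP sRX).
  apply: (@copy_add_path _ A f S u _ (r :: ws)) => //=.
  - by apply: copyS fc => //; apply: subsetDl.
  - by rewrite fur.
  - by move=> w /sX/(subsetP sXA).
  - move=> w /sX wX; apply/imsetP => -[y yS wy].
    by case: fc => _ /(_ y yS) + _; rewrite -wy inE wX.
right; rewrite size_map in cXR.
apply: colourable_onS (colourable_onU cA (colourable_onU cR cXR)).
by apply/subsetP=> v vA; rewrite !inE vA; case: (v \in X); case: (v \in R).
Qed.

(** * Trees with few leaves *)

Definition leaves S := [set x in S | #|[set y in S | adjacent x y]| == 1].

Lemma attached_adjacent S y b x : attached S y b x -> adjacent x y.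
Proof. by case=> _ _ yx _; rewrite (adjacentE b) yx orbT. Qed.

Lemma leaf_attached S x : x \in leaves S -> exists y b, attached (S :\ x) y b x.
Proof.
rewrite inE => /andP[xS /cards1P[y ny]].
have : y \in [set y in S | adjacent x y] by rewrite ny set11.
rewrite inE => /andP[yS xy].
have yx : y != x by apply: contraTneq xy => ->; rewrite adjacent_irrefl.
exists y, (dir true y x); split; rewrite ?setD11 //; first by rewrite !inE yx.
  by move: xy; rewrite (adjacentE true); case: (boolP (dir true y x)) => //; rewrite orbF.
move=> z /setD1P[_ zS] zx; apply/set1P.
by rewrite -ny inE zS adjacent_sym.
Qed.

Lemma tree_set_isolated S x : tree_set S -> x \in S ->
  {in S, forall y, ~~ adjacent x y} -> S = [set x].
Proof.
move=> trS; elim: trS x => [z|S0 y b z trS IH att] x; first by move=> /set1P->.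
have zy := attached_adjacent att; case: att => zS yS _ _.
case/setU1P=> [->|xS] iso.
  by have := iso y; rewrite !inE yS orbT zy => /(_ isT).
have eS : S0 = [set x] by apply: IH => // t tS; apply: iso; rewrite inE tS orbT.
have yx : y = x by apply/set1P; rewrite -eS.
by have := iso z (setU11 _ _); rewrite adjacent_sym -yx zy.
Qed.

(** Any leaf can be removed, not only the one that was added last. The one delicate
    case is that x is the foot y of the last leaf z: being a leaf, x is then alone
    in S0. *)
Lemma tree_setD1 S x : tree_set S -> x \in leaves S -> tree_set (S :\ x).
Proof.
move=> trS; elim: trS x => [z|S0 y b z trS IH att] x.
  rewrite !inE => /andP[/eqP-> /cards1P[y ny]].
  have : y \in [set t in [set z] | adjacent z t] by rewrite ny set11.
  by rewrite !inE => /andP[/eqP->]; rewrite adjacent_irrefl.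
have zy := attached_adjacent att; case: (att) => zS yS yz zP.
have [-> _|xz] := eqVneq x z; first by rewrite setU1K.
rewrite inE => /andP[/setU1P[/eqP|xS]]; first by rewrite (negPf xz).
have [xy nx|xy] := eqVneq x y.
  have S0x : S0 = [set x].
    apply: tree_set_isolated => // t tS; apply/negP => xt.
    have /cards1P[s ns] := nx; have eqs w : w \in z |: S0 -> adjacent x w -> w = s.
      by move=> wS xw; apply/set1P; rewrite -ns inE wS.
    have zs : z = s by apply: eqs; rewrite ?setU11 // adjacent_sym xy.
    have ts : t = s by apply: eqs; rewrite // inE tS orbT.
    by move: zS; rewrite zs -ts tS.
  rewrite (_ : (z |: S0) :\ x = [set z]); first exact: tree_set1.
  rewrite S0x; apply/setP=> t; rewrite !inE.
  by have [->|] := eqVneq t x; rewrite ?orbF //= (negPf xz).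
move=> nx; have -> : (z |: S0) :\ x = z |: (S0 :\ x).
  by apply/setP=> t; rewrite !inE; have [->|//] := eqVneq t z; rewrite eq_sym xz.
apply: (@tree_setU1 _ y b); last first.
  split=> // [||t /setD1P[_ tS]]; last exact: zP.
    by rewrite !inE (negPf zS) andbF.
  by rewrite !inE yS eq_sym xy.
apply: IH; rewrite inE xS /=; rewrite -(eqP nx); apply/eqP/eq_card => t.
rewrite !inE; have [->|//] := eqVneq t z; rewrite (negPf zS) /=.
by apply/esym; apply: contra_neqF xy => /zP->.
Qed.

Lemma tree_set_leaf S : tree_set S -> 1 < #|S| -> exists x, x \in leaves S.
Proof.
case=> [x|S0 y b x trS att]; first by rewrite cards1.
have xy := attached_adjacent att; case: att => xS yS _ xP _; exists x.
rewrite inE setU11; apply/cards1P; exists y; apply/setP=> t; rewrite !inE.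
have [->|tx] := eqVneq t x.
  by rewrite adjacent_irrefl; apply/esym; apply: contraNF xS => /eqP->.
apply/idP/eqP => [/andP[tS]|->]; last by rewrite yS xy.
by rewrite adjacent_sym; apply: xP.
Qed.

(** Removing the leaf x can turn only its neighbour y into a new leaf. *)
Lemma leavesD1 S x y b : x \in S -> attached (S :\ x) y b x ->
  leaves (S :\ x) :\ y \subset leaves S :\ x.
Proof.
move=> xS [_ _ _ xP]; apply/subsetP=> t; rewrite !inE.
case/and3P=> ty /andP[tx tS] /eqP nt; rewrite tx tS /= -nt; apply/eqP/eq_card => s.
rewrite !inE; have [->|//] := eqVneq s x; rewrite xS /=.
by apply: contra_neqF ty => /xP->; rewrite // !inE tx.
Qed.

(** Climb from a leaf as long as the foot u of the path has become a leaf itself. If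
    the climb stops before p vertices are collected, then u still has
    at least two neighbours, or none, and a leaf has been lost. *)
Lemma exists_pendant_path p S : 0 < p -> tree_set S -> 1 < #|S| ->
  exists S' u l, [/\ tree_set S', u \in S', pendant_path S' u l, add_path S' l = S &
    0 < size l <= p /\
    (size l = p /\ #|leaves S'| <= #|leaves S| \/ #|leaves S'| < #|leaves S|)].
Proof.
move=> p0 trS S1.
(* Discounting u keeps the count strict during the climb: u is the only leaf that
   removing the path can have created. *)
suff walk_up n : n < p -> exists S' u l,
    [/\ tree_set S', u \in S', pendant_path S' u l, add_path S' l = S &
     [/\ 0 < size l <= p, #|leaves S' :\ u| < #|leaves S|
       & size l = n.+1 \/ u \notin leaves S']].
  have [|S' [u [l [trS' uS' hl hSl [szl lu szu]]]]] := walk_up p.-1; first by lia.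
  exists S', u, l; split=> //; split=> //.
  case: szu => [sz|uL].
    left; split; first by rewrite sz prednK.
    by move: lu; rewrite (cardsD1 u (leaves S')); case: (u \in _) => /=; lia.
  by right; move: lu; rewrite [in X in _ -> X](cardsD1 u (leaves S')) (negPf uL).
have card_leaves S0 x y b : x \in leaves S0 -> attached (S0 :\ x) y b x ->
    #|leaves (S0 :\ x) :\ y| <= #|leaves S0 :\ x|.
  by rewrite inE => /andP[xS _] att; apply: subset_leq_card (leavesD1 xS att).
elim: n => [_|n IHn n_p].
  have [x xL] := tree_set_leaf trS S1; have [y [b att]] := leaf_attached xL.
  have xS : x \in S by move: xL; rewrite inE => /andP[].
  exists (S :\ x), y, [:: (b, x)]; split=> //=.
  - exact: tree_setD1.
  - by case: att.
  - by rewrite setD1K.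
  - split=> //; last by left.
    by apply: leq_ltn_trans (card_leaves _ _ _ _ xL att) _; rewrite (cardsD1 x (leaves S)) xL.
have [|S' [u [l [trS' uS' hl hSl [szl lu szu]]]]] := IHn; first exact: ltnW.
have [uL|uL] := boolP (u \in leaves S'); last by exists S', u, l; split=> //; split=> //; right.
have sz : size l = n.+1 by case: szu => //; rewrite uL.
have [y [b att]] := leaf_attached uL.
exists (S' :\ u), y, ((b, u) :: l); split=> //=; rewrite ?setD1K //.
- exact: tree_setD1.
- by case: att.
- split; [by rewrite sz | | by left; rewrite sz].
  by apply: leq_ltn_trans lu; apply: card_leaves uL att.
Qed.

(** Each pendant path of [exists_pendant_path] uses up either p vertices or a leaf, so
    q + l of them suffice. *)
Lemma forced_few_leaves p N q l S : 0 < p -> tree_set S -> #|S| <= N ->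
  #|S| <= p * q + 1 -> #|leaves S| <= l -> forced S ((q + l) * (N.-1 + 'C(p, 2))).
Proof.
move=> p0; have [n] := ubnP #|S|; elim: n S q l => // n IHn S q l Sn trS SN Sq Sl.
have [S1|S1] := leqP #|S| 1.
  have /cards1P[x ->] : #|S| == 1 by rewrite eqn_leq S1 tree_set_gt0.
  by apply: forcedW (forced1 x).
have [S' [u [r [trS' uS' hr hSr [/andP[r0 rp] lr]]]]] := exists_pendant_path p0 trS S1.
have cS := card_add_path hr; rewrite hSr in cS.
have step q' l' : #|S'| <= p * q' + 1 -> #|leaves S'| <= l' -> q' + l' < q + l ->
    forced S ((q + l) * (N.-1 + 'C(p, 2))).
  move=> Sq' Sl' ql; rewrite -hSr.
  have fS' : forced S' ((q' + l') * (N.-1 + 'C(p, 2))) by apply: IHn => //; lia.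
  apply: forcedW (forced_add_path trS' uS' hr fS'); rewrite hSr.
  have : (q' + l').+1 * (N.-1 + 'C(p, 2)) <= (q + l) * (N.-1 + 'C(p, 2)).
    by rewrite leq_mul2r ql orbT.
  apply: leq_trans; rewrite mulSn addnC leq_add2r leq_add ?leq_bin2l //; lia.
case: lr => [[rp' ll]|ll].
- have q0 : 0 < q by case: (q) Sq => // ; lia.
  apply: (step q.-1 l); [ | lia | lia].
  by case: q q0 Sq {step} => //= q _; rewrite mulnS; lia.
- by apply: (step q l.-1); lia.
Qed.

(** * Removing all leaves of one direction *)

Definition leaves_of b S := [set x in leaves S | [exists y in S, dir b y x]].

Lemma card_leaves_of S : #|leaves S| <= #|leaves_of true S| + #|leaves_of false S|.
Proof.
rewrite (leq_trans _ (leq_card_setU _ _)) // subset_leq_card //.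
apply/subsetP=> x xL; rewrite !inE -andb_orr; move: (xL); rewrite !inE => -> /=.
have [y [b [_ /setD1P[_ yS] yx _]]] := leaf_attached xL.
by case: b yx => yx; apply/orP; [left | right]; apply/existsP; exists y; rewrite yS.
Qed.

(** The neighbour y of x is not in the removed set: it could be a leaf only if S were
    {x, y}, and then its direction as a leaf is the opposite one. *)
Lemma leaves_of_attached b S x : x \in leaves_of b S ->
  exists2 y, y \in S :\: leaves_of b S & attached (S :\ x) y b x.
Proof.
rewrite inE => /andP[xL /existsP[y /andP[yS yx]]].
have [z [c [xS' zS zx xP]]] := leaf_attached xL.
have ny : y != x by apply: contraTneq yx => ->; rewrite dir_irrefl.
have yz : y = z by apply: xP; rewrite ?(adjacentE b) ?yx // !inE ny.
rewrite -{z}yz in zS zx xP; exists y; last by split.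
rewrite in_setD yS andbT; apply/negP; rewrite inE => /andP[yL /existsP[t /andP[tS ty]]].
have tx : t = x.
  move: yL; rewrite inE => /andP[_ /cards1P[s ns]].
  have xS : x \in S by move: xL; rewrite inE => /andP[].
  have -> : t = s by apply/set1P; rewrite -ns inE tS (adjacentE b) ty orbT.
  by apply/esym/set1P; rewrite -ns inE xS (adjacentE b) yx.
rewrite tx in ty; have := orT (x := x) (y := y); have := orT (x := y) (y := x).
by case: b yx ty {yL} => /= -> -> // /(_ isT).
Qed.

Lemma attachedS S S' y b x : S' \subset S -> y \in S' -> attached S y b x -> attached S' y b x.
Proof.
move=> /subsetP sS yS' [xS _ yx xP]; split=> //; first by apply: contra xS; apply: sS.
by move=> z /sS; apply: xP.
Qed.

Lemma tree_setD_leaves_of b S : tree_set S -> tree_set (S :\: leaves_of b S).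
Proof.
move=> trS; suff : forall L : {set T}, L \subset leaves_of b S -> tree_set (S :\: L) by apply.
move=> L; have [n] := ubnP #|L|; elim: n L => // n IHn L Ln sL.
have [->|[x xL]] := set_0Vmem L; first by rewrite setD0.
have sLx : L :\ x \subset leaves_of b S := subset_trans (subsetDl _ _) sL.
have [y yS att] := leaves_of_attached (subsetP sL x xL).
have -> : S :\: L = (S :\: (L :\ x)) :\ x.
  by apply/setP=> t; rewrite !inE; have [->|] := eqVneq t x; rewrite ?xL.
apply: tree_setD1; first by apply: IHn => //; rewrite (cardsD1 x L) xL in Ln.
have xS : x \in S by have := subsetP sL x xL; rewrite !inE => /andP[/andP[]].
rewrite !inE eqxx xS /=; apply/cards1P; exists y; apply/setP=> t; rewrite !inE.
have xy := attached_adjacent att; case: att => _ _ _ xP.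
apply/idP/eqP => [/andP[/andP[_ tS] xt]|->].
  apply: xP; rewrite 1?adjacent_sym // !inE tS andbT.
  by apply: contraTneq xt => ->; rewrite adjacent_irrefl.
case/setDP: yS => yS yL; rewrite yS xy !andbT negb_and.
by rewrite (contra (subsetP sL y) yL) orbT.
Qed.

(** The vertices of A with fewer than |S| neighbours in direction b are sparse; at the
    others a free neighbour remains as long as fewer than |S| vertices are used. *)
Lemma forced_leaves_of b S m : tree_set S -> forced (S :\: leaves_of b S) m ->
  forced S (m + #|S|.*2).
Proof.
move=> trS fS D A; set L := leaves_of b S in fS.
have sLS : L \subset S by apply/subsetP=> x; rewrite !inE => /andP[/andP[]].
pose G := [set v in A | #|S| <= #|nbrs b A v|].
have cB : colourable_on (A :\: G) #|S|.*2.
  have lt2 : (#|S|.-1).*2.+1 <= #|S|.*2 by have := tree_set_gt0 trS; lia.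
  apply: colourable_onW lt2 (@colourable_on_sparse _ b _ _ _) => v.
  rewrite !inE => /andP[+ vA]; rewrite vA /= -ltnNge => lt.
  apply: leq_trans (_ : #|nbrs b A v| <= _); last by rewrite -ltnS (ltn_predK lt).
  by apply/subset_leq_card/subsetP=> w; rewrite !inE => /andP[/andP[_ ->]].
have [[f fc]|cG] := fS D G; last first.
  right; apply: colourable_onS (colourable_onU cG cB).
  by apply/subsetP=> v vA; rewrite in_setU in_setD vA andbT orbN.
left; suff : forall L' : {set T}, L' \subset L -> exists2 f', copy f' ((S :\: L) :|: L') A &
    {in S :\: L, f =1 f'}.
  move=> /(_ L (subxx _))[f' + _].
  by rewrite setUC setDE setUIr setUCr setIT (setUidPr sLS); exists f'.
move=> L'; have [n] := ubnP #|L'|; elim: n L' => // n IHn L' L'n sL'.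
have [->|[x xL']] := set_0Vmem L'.
  exists f => //; rewrite setU0; apply: copyS fc => //.
  by apply/subsetP=> v; rewrite inE => /andP[].
have xL : x \in L := subsetP sL' x xL'.
have [||f' fc' ff'] := IHn (L' :\ x).
- by rewrite (cardsD1 x L') xL' in L'n.
- exact: subset_trans (subsetDl _ _) sL'.
set S' := (S :\: L) :|: (L' :\ x) in fc'.
have [y yS att] := leaves_of_attached xL.
have sS' : S' \subset S :\ x.
  apply/subsetP=> t; rewrite !inE => /orP[/andP[tL tS]|/andP[-> tL']].
    by rewrite tS andbT; apply: contraNneq tL => ->; have := xL; rewrite !inE.
  by rewrite (subsetP sLS) // (subsetP sL').
have yS' : y \in S' by rewrite inE yS.
have [w] : exists w, w \in nbrs b A (f' y) :\: f' @: S'.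
  apply/set0Pn; rewrite -card_gt0 cardsD subn_gt0.
  have fyG : f' y \in G by rewrite -ff' //; case: fc => _ fA _; apply: fA.
  move: fyG; rewrite inE => /andP[_]; apply: leq_trans.
  apply: leq_ltn_trans (_ : #|S'| < _).
    by apply: leq_trans (subset_leq_card (subsetIr _ _)) (leq_imset_card _ _).
  apply: leq_ltn_trans (subset_leq_card sS') _.
  by rewrite [X in _ < X](cardsD1 x) (subsetP sLS).
rewrite inE => /andP[wS']; rewrite inE => /andP[wA fyw].
exists (fun z => if z == x then w else f' z); last first.
  move=> t tS; rewrite ff' //; case: eqP => // tx.
  by move: tS; rewrite tx inE xL.
have -> : (S :\: L) :|: L' = x |: S' by rewrite /S' setUCA setD1K.
exact: copyU1 fc' (attachedS sS' yS' att) wA wS' fyw.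
Qed.

(** * From graph-theoretic trees to sets built leaf by leaf *)

Lemma tree_set_connected S : tree_set S ->
  {in S &, forall x y, connect [rel s t | [&& s \in S, t \in S & adjacent s t]] x y}.
Proof.
elim=> [z|S0 y b z trS IH att] s t; first by move=> /set1P-> /set1P->; apply: connect0.
set e := [rel s t | _]; have zy := attached_adjacent att; case: att => zS yS _ _.
have e_sym : connect_sym e.
  by apply: sym_connect_sym => u v; rewrite /e /= adjacent_sym andbCA.
have sub u v : u \in S0 -> v \in S0 -> connect e u v.
  move=> uS vS; apply: connect_sub (IH u v uS vS) => a c /and3P[aS cS ac].
  by apply: connect1; rewrite /e /= !inE aS cS ac !orbT.
have ezy : connect e z y by apply: connect1; rewrite /e /= !inE eqxx yS zy orbT.
case/setU1P=> [->|sS] /setU1P[->|tS]; rewrite ?connect0 //.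
- exact: connect_trans ezy (sub _ _ yS tS).
- by rewrite e_sym; apply: connect_trans ezy (sub _ _ yS sS).
- exact: sub.
Qed.

(** Connectedness provides a vertex x outside S adjacent to some y in S; two such
    neighbours would close a cycle with a path joining them inside S. *)
Lemma tree_setT : tree (underlying T) -> tree_set [set: T].
Proof.
case=> -[T0 conT] acT.
have grow S : tree_set S -> S != setT -> exists2 x, x \notin S & tree_set (x |: S).
  move=> trS ST; have /set0Pn[s sS] : S != set0 by rewrite -card_gt0 tree_set_gt0.
  have /subsetPn[z _ zS] : ~~ ([set: T] \subset S) by rewrite subTset.
  have [[y x] /= /and3P[yS xS yx]|noarc] :=
      pickP (fun u : T * T => [&& u.1 \in S, u.2 \notin S & adjacent u.1 u.2]).
    exists x => //; apply: (@tree_setU1 _ y (dir true y x)) => //; split=> //.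
      by move: yx; rewrite (adjacentE true); case: (boolP (dir true y x)).
    move=> t tS tx; apply/eqP; apply: contraT => ty.
    have /connectP[p pth lst] := tree_set_connected trS yS tS.
    case: (shortenP pth) lst => {pth} p' pth uniq_p' _ lst.
    have pS : {subset y :: p' <= S}.
      move=> w; rewrite inE => /predU1P[->//|].
      elim: p' y pth {uniq_p' lst yS yx ty} => //= a p' IHp y /andP[/and3P[_ aS _] pth].
      by rewrite inE => /predU1P[->//|]; apply: IHp pth.
    have adjp : path (@adjacent T) y p'.
      by apply: sub_path pth => a c /and3P[].
    case: (acT (x :: y :: p')).
      by case: p' lst {pth uniq_p' pS adjp} => // ty'; rewrite ty' eqxx in ty.
    apply/andP; split; last by rewrite cons_uniq uniq_p' andbT; apply: contra xS; apply: pS.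
    by rewrite /= rcons_path -lst; apply/and3P; split=> //; rewrite /= adjacent_sym.
  have clS : closed (@edge (underlying T)) (mem S).
    move=> u v; change (adjacent u v -> (u \in S) = (v \in S)) => uv.
    have := noarc (u, v); have := noarc (v, u) => /=.
    by rewrite [adjacent v u]adjacent_sym uv !andbT; case: (u \in S); case: (v \in S).
  have : (s \in S) = (z \in S) := closed_connect clS (conT s z).
  by rewrite sS (negPf zS).
have [x0 _] : exists x : T, x \in T by apply/card_gt0P.
suff : forall n S, #|~: S| <= n -> tree_set S -> tree_set [set: T].
  by move=> /(_ _ _ (leqnn _) (tree_set1 x0)).
elim=> [|n IHn] S Sn trS; have [<-//|ST] := eqVneq S setT.
  by move: Sn; rewrite leqn0 cards_eq0 -setCT (inj_eq (@setC_inj T)) (negPf ST).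
have [x xS trxS] := grow S trS ST; apply: IHn trxS; rewrite -ltnS.
apply: leq_trans Sn; rewrite (cardsD1 x (~: S)) inE xS add1n ltnS subset_leq_card //.
by apply/subsetP=> t; rewrite !inE negb_or.
Qed.

End Trees.

(** * Balancing the two operations *)

Section Bound.
Variable R : rcfType.
Local Open Scope ring_scope.

(** The variable is the square root of the order. The value 73/25 is slightly
    smaller than 8 sqrt(2/15). *)
Definition order_bound (x : R) : R := 73 / 25 * x ^+ 3 + 11 / 3 * x ^+ 2.

(** A tree of order x^2 with at least 93/100 x leaves has at least 93/200 x leaves of
    one direction; z^2 is the order that remains without these. *)
Lemma order_bound_leaves (x z : R) : 1 <= x -> 0 <= z ->
  93 / 200 * x <= x ^+ 2 - z ^+ 2 -> order_bound z + 2 * x ^+ 2 <= order_bound x.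
Proof.
rewrite /order_bound => x1 z0 hd; have zx : z <= x by nra.
(* For z close to x the cubes differ by about 3/2 x (x^2 - z^2), and the quadratic
   term makes up for the curvature; for z far from x the cubic term is enough. *)
have [near|far] := lerP (x - 8 / 5) z.
  have cube : 3 / 4 * ((x ^+ 2 - z ^+ 2) * (x + z)) <= x ^+ 3 - z ^+ 3.
    rewrite -subr_ge0 (_ : _ - _ = (x - z) * (x - z) ^+ 2 / 4); last by field.
    by rewrite !mulr_ge0 ?sqr_ge0 ?subr_ge0 ?invr_ge0 ?ler0n.
  nra.
have cube : 8 / 5 * x ^+ 2 <= x ^+ 3 - z ^+ 3.
  rewrite (_ : _ - _ = (x - z) * (x ^+ 2 + x * z + z ^+ 2)); last by ring.
  by apply: ler_pM; nra.
nra.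
Qed.

(** Here c stands for p(p-1)/2, with p the square root of n rounded up. *)
Lemma order_bound_few_leaves (x p l c n : R) : 1 <= x -> n = x ^+ 2 -> 0 <= p -> p <= x + 1 ->
  0 <= l -> l <= 93 / 100 * x -> 0 <= c -> 2 * c <= p * (p - 1) ->
  (p + l) * (n + c) <= order_bound x.
Proof.
rewrite /order_bound => x1 -> p0 px l0 lx c0 cp.
have cx : c <= (x ^+ 2 + x) / 2 by nra.
apply: le_trans (_ : (x + 1 + 93 / 100 * x) * (x ^+ 2 + (x ^+ 2 + x) / 2) <= _).
  by apply: ler_pM; nra.
nra.
Qed.

Lemma forced_order_bound (T : digraph) (S : {set T}) (m : nat) :
    oriented T -> tree_set S -> order_bound (Num.sqrt #|S|%:R) <= m%:R ->
  forced S m.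
Proof.
move=> orT; have [n] := ubnP #|S|; elim: n S m => // n IHn S m Sn trS.
set x := Num.sqrt _ => bm; have S0 := tree_set_gt0 trS.
have xS : #|S|%:R = x ^+ 2 by rewrite sqr_sqrtr ?ler0n.
have x1 : 1 <= x by rewrite -[1]sqrtr1 ler_sqrt ?ltr01 ?ler1n // ltr0n.
have [many|few] := lerP (93 / 100 * x) #|leaves S|%:R.
  have [b Lb] : exists b, (#|leaves S| <= #|leaves_of b S|.*2)%N.
    have := card_leaves_of S; have [le|lt] := leqP #|leaves_of true S| #|leaves_of false S|.
      by exists false; lia.
    by exists true; lia.
  have sL : leaves_of b S \subset S by apply/subsetP=> y; rewrite !inE => /andP[/andP[]].
  have cS : (#|S :\: leaves_of b S| + #|leaves_of b S| = #|S|)%N.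
    by rewrite addnC -[RHS](cardsID (leaves_of b S)) (setIidPr sL).
  have hd : 93 / 200 * x <= x ^+ 2 - Num.sqrt #|S :\: leaves_of b S|%:R ^+ 2.
    rewrite sqr_sqrtr ?ler0n // -xS -cS natrD.
    have : #|leaves S|%:R <= 2 * #|leaves_of b S|%:R :> R.
      by rewrite -natrM ler_nat mul2n.
    lra.
  have := order_bound_leaves x1 (sqrtr_ge0 _) hd.
  rewrite -xS; set h := order_bound _ => hh.
  have h0 : 0 <= h.
    by rewrite /h /order_bound addr_ge0 // mulr_ge0 ?exprn_ge0 ?sqrtr_ge0 //; lra.
  have Sm : (#|S|.*2 <= m)%N by rewrite -(ler_nat R) -mul2n natrM; lra.
  rewrite -(subnK Sm); apply: (forced_leaves_of orT (b := b) trS); apply: IHn.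
  - apply: leq_trans (_ : #|S| <= n)%N; last by rewrite -ltnS.
    rewrite -cS -[X in (X < _)%N]addn0 ltn_add2l.
    by rewrite -double_gt0 (leq_trans _ Lb) // -(ltr_nat R); lra.
  - exact: tree_setD_leaves_of.
  - by rewrite natrB // -mul2n natrM -/h; lra.
(* p is the square root of the order, rounded up. *)
have [p p0 [Sp pS]] : exists2 p, (0 < p)%N & (#|S| <= p * p)%N /\ (p.-1 * p.-1 < #|S|)%N.
  have ex : exists p, (#|S| <= p * p)%N by exists #|S|; rewrite leq_pmulr.
  exists (ex_minn ex); case: ex_minnP => -[|p] //= Sp minp; first by move: (leq_trans S0 Sp).
  by split=> //; rewrite ltnNge; apply/negP => /minp; rewrite ltnn.
have px : p%:R <= x + 1.
  have : p.-1%:R <= x.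
    by rewrite -(ler_pXn2r (n := 2)) ?nnegrE ?sqrtr_ge0 // -xS -natrX ler_nat -mulnn ltnW.
  by rewrite -[in X in _ -> X](prednK p0) -natr1; lra.
apply: forcedW (forced_few_leaves orT (q := p) p0 trS (leqnn _) _ (leqnn _)); last first.
  by rewrite (leq_trans Sp) // leq_addr.
rewrite -(ler_nat R) (le_trans _ bm) // natrM natrD natrD.
have c2 : 2 * 'C(p, 2)%:R <= p%:R * (p%:R - 1) :> R.
  have -> : p%:R - 1 = p.-1%:R :> R by rewrite -[in LHS](prednK p0) -natr1 addrK.
  by rewrite -!natrM ler_nat bin2; lia.
apply: le_trans (_ : (p%:R + #|leaves S|%:R) * (#|S|%:R + 'C(p, 2)%:R) <= _).
  by rewrite ler_wpM2l ?addr_ge0 ?ler0n // lerD2r ler_nat leq_pred.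
by apply: order_bound_few_leaves c2; rewrite ?ler0n // ltW.
Qed.

End Bound.

Local Open Scope ring_scope.

Theorem theorem3 (R : realType) (k : nat) (T : digraph) :
  (1 <= k)%N -> oriented_tree T -> #|T| = k ->
  universal (8 * Num.sqrt (2 / 15) * (k%:R * Num.sqrt k%:R)
             + 11 / 3 * k%:R
             + Num.sqrt (5 / 6) * Num.sqrt k%:R
             + 1 : R) T.
Proof.
move=> _ [orT treeT] <- D chiD; set x := Num.sqrt #|T|%:R in chiD.
have xT : #|T|%:R = x ^+ 2 by rewrite sqr_sqrtr ?ler0n.
have x0 : 0 <= x := sqrtr_ge0 _.
have K : 73 / 25 <= 8 * Num.sqrt (2 / 15) :> R.
  have : 73 / 200 <= Num.sqrt (2 / 15) :> R.
    by rewrite -[leLHS]ger0_norm ?divr_ge0 ?ler0n // -sqrtr_sqr ler_sqrt; lra.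
  lra.
have hT : order_bound (Num.sqrt #|[set: T]|%:R : R) + 1 <= (chi D)%:R.
  apply: le_trans chiD; rewrite lerD2r cardsT -/x xT /order_bound -exprSr.
  have : 0 <= Num.sqrt (5 / 6) * x by rewrite mulr_ge0 ?sqrtr_ge0.
  have : 73 / 25 * x ^+ 3 <= 8 * Num.sqrt (2 / 15) * x ^+ 3.
    by rewrite ler_wpM2r ?exprn_ge0.
  lra.
have chi0 : (0 < chi D)%N.
  rewrite -(ltr_nat R); apply: lt_le_trans hT.
  by rewrite ltr_wpDl // /order_bound addr_ge0 // mulr_ge0 ?exprn_ge0 ?sqrtr_ge0 //; lra.
have hm : order_bound (Num.sqrt #|[set: T]|%:R : R) <= (chi D).-1%:R.
  by rewrite -(prednK chi0) -natr1 lerD2r in hT.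
have [[f [fI _ farc]]|/colourable_on_setT] :=
    forced_order_bound orT (tree_setT treeT) hm [set: D].
  by exists f; split=> [y z|y z]; [apply: fI | apply: farc].
by rewrite -ltnS prednK // ltnn.
Qed.
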